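(* Let $(X,\langle\cdot,\cdot\rangle)$ be a real Hilbert space, let $z\in X$ with $z\neq 0$, and let $T:X\to X$ be a continuous linear operator which is compact and symmetric. For each $\lambda>\|T\|$, let $\hat v_\lambda$ denote the unique solution $x\in X$ of the equation $T(x)-\lambda x=z$ (it exists and is unique by the contraction mapping theorem, and it is nonzero). Let $V$ be the (possibly empty) set of all solutions $x\in X$ of $T(x)-\|T\|x=z$, and set $\theta=\inf_{x\in V}\|x\|^2$ (with the convention $\inf\emptyset=+\infty$). For each $r>0$ let $S_r=\{x\in X:\|x\|^2=r\}$. For $\lambda>\|T\|$ and $r>0$ set $$g(\lambda)=\|\hat v_\lambda\|^2,\qquad \gamma(r)=\sup_{x\in S_r}J(x),\quad\text{where } J(x)=\langle T(x)-2z,x\rangle .$$ Then: $(b_1)$ the function $g$ is decreasing in $]\|T\|,+\infty[$ and $g(]\|T\|,+\infty[)=]0,\theta[$; $(b_2)$ for each $r\in]0,\theta[$, the point $\hat x_r:=\hat v_{g^{-1}(r)}$ is the unique global maximum of $J|_{S_r}$, and every maximizing sequence for $J|_{S_r}$ converges (in norm) to $\hat x_r$; $(b_3)$ the function $r\mapsto \hat x_r$ is continuous in $]0,\theta[$; $(b_4)$ the function $\gamma$ is $C^1$, increasing and strictly concave in $]0,\theta[$; $(b_5)$ $T(\hat x_r)-\gamma'(r)\hat x_r=z$ for all $r\in]0,\theta[$; $(b_6)$ $\gamma'(r)=g^{-1}(r)$ for all $r\in]0,\theta[$.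
   Context: A linear operator $T$ is compact if for each bounded $A\subset X$ the closure $\overline{T(A)}$ is compact; it is symmetric if $\langle T(x),u\rangle=\langle T(u),x\rangle$ for all $x,u\in X$. $\|T\|$ denotes the operator norm. Note $\theta$ may equal $+\infty$, in which case $]0,\theta[=]0,+\infty[$. *)

(* Defs.v *)
From HB Require Import structures.
From mathcomp Require Import all_boot all_order all_algebra.
From mathcomp Require Import all_classical all_reals all_analysis.
Set Implicit Arguments. Unset Strict Implicit. Unset Printing Implicit Defensive.
Import Order.TTheory GRing.Theory Num.Theory.
Import numFieldNormedType.Exports.
Local Open Scope classical_set_scope.
Local Open Scope ring_scope.

(* A real Hilbert space is a complete normed space X whose norm is induced by
   an inner product [ip]: [ip] is symmetric, linear in its first argument
   (hence bilinear), and [ip x x = `|x|^2]. *)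
Definition is_inner_product (R : realType) (X : normedModType R)
  (ip : X -> X -> R) : Prop :=
  [/\ (forall x y, ip x y = ip y x),
      (forall x y w, ip (x + y) w = ip x w + ip y w),
      (forall (a : R) x y, ip (a *: x) y = a * ip x y) &
      (forall x, ip x x = `|x| ^+ 2)].

Definition opnorm (R : realType) (X : normedModType R) (T : X -> X) : R :=
  sup [set `|T x| | x in [set x : X | `|x| <= 1]].

Definition compact_op (R : realType) (X : normedModType R) (T : X -> X) : Prop :=
  forall A : set X, bounded_set A -> compact (closure (T @` A)).

Definition symmetric_op (R : realType) (X : normedModType R)
  (ip : X -> X -> R) (T : X -> X) : Prop :=
  forall x u, ip (T x) u = ip (T u) x.

Section Defs.
Context (R : realType) (X : completeNormedModType R)
  (ip : X -> X -> R) (T : X -> X) (z : X).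

(* \hat v_lambda : the (unique, for lambda > ||T||) solution of T x - lambda x = z *)
Definition vhat (l : R) : X := xget 0 [set x | T x - l *: x = z].

Definition gfun (l : R) : R := `|vhat l| ^+ 2.

(* V = solutions of T x - ||T|| x = z ; theta = inf_{x in V} ||x||^2 (inf of empty = +oo) *)
Definition Vset : set X := [set x | T x - opnorm T *: x = z].
Definition theta : \bar R := ereal_inf [set ((`|x| ^+ 2)%:E) | x in Vset].

Definition Sr (r : R) : set X := [set x | `|x| ^+ 2 = r].

Definition Jfun (x : X) : R := ip (T x - 2%:R *: z) x.

Definition gamma (r : R) : R := sup [set Jfun x | x in Sr r].

Definition ginv (r : R) : R := xget 0 [set l | opnorm T < l /\ gfun l = r].

Definition xhat (r : R) : X := vhat (ginv r).

Definition Itheta : set R := [set r | 0 < r /\ (r%:E < theta)%E].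
End Defs.

(* Main.v *)
(** Write [nT] for the operator norm. If [x] and [y] solve [T x - m x = z] and
    [T y - l y = z] with [nT <= m < l], positivity of [m - T] gives
    [|x - y|^2 <= |x|^2 - |y|^2]. Hence [g] is decreasing, the values of [g] stay
    below [theta], and if [g] is bounded near [nT] then the solutions form a Cauchy
    family whose limit solves the equation at [nT]; with the intermediate value
    theorem this gives the range of [g], and continuity of [xhat] is immediate.
    Completing the square, the solution [x] at [l] satisfies
    [J y + (l - nT) |y - x|^2 <= J x + l (|y|^2 - |x|^2)] for all [y].
    On a sphere this yields the maximality statements, and across spheres it
    says that [ginv r] is a strict supergradient of [gamma] at [r], whence
    differentiability and strict concavity. *)

Require Import Defs.
From HB Require Import structures.
From mathcomp Require Import all_boot all_order all_algebra.
From mathcomp Require Import all_classical all_reals all_analysis.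
From mathcomp Require Import ring lra.
Set Implicit Arguments.
Unset Strict Implicit.
Unset Printing Implicit Defensive.
Import Order.TTheory GRing.Theory Num.Theory.
Import numFieldNormedType.Exports.
Local Open Scope classical_set_scope.
Local Open Scope ring_scope.

(** * Bilinearity and the Cauchy-Schwarz inequality *)

Section InnerProduct.
Context (R : realType) (X : normedModType R) (ip : X -> X -> R)
  (ipP : is_inner_product ip).

Lemma ipC x y : ip x y = ip y x. Proof. by case: ipP. Qed.

Lemma ipDl x y w : ip (x + y) w = ip x w + ip y w. Proof. by case: ipP. Qed.

Lemma ipZl a x y : ip (a *: x) y = a * ip x y. Proof. by case: ipP. Qed.

Lemma ip_norm x : ip x x = `|x| ^+ 2. Proof. by case: ipP. Qed.

Lemma ipDr x y w : ip w (x + y) = ip w x + ip w y.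
Proof. by rewrite ipC ipDl !(ipC w). Qed.

Lemma ipZr a x y : ip x (a *: y) = a * ip x y.
Proof. by rewrite ipC ipZl ipC. Qed.

Lemma ipBl x y w : ip (x - y) w = ip x w - ip y w.
Proof. by rewrite -scaleN1r ipDl ipZl mulN1r. Qed.

Lemma ipBr x y w : ip w (x - y) = ip w x - ip w y.
Proof. by rewrite ipC ipBl !(ipC w). Qed.

Lemma ip_le_norm x y : ip x y <= `|x| * `|y|.
Proof.
have [x0|x0] := eqVneq x 0.
  by rewrite x0 -[X in ip X y](scale0r 0) ipZl mul0r normr0 mul0r.
have [y0|y0] := eqVneq y 0.
  by rewrite y0 -[X in ip x X](scale0r 0) ipZr mul0r normr0 mulr0.
have xy0 : 0 < `|x| * `|y| by rewrite mulr_gt0// normr_gt0.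
(* This square expands to [2 |x| |y| (|x| |y| - ip x y)]; the positive factor is then divided
   out. *)
have : 0 <= ip (`|y| *: x - `|x| *: y) (`|y| *: x - `|x| *: y).
  by rewrite ip_norm sqr_ge0.
rewrite !(ipBl, ipBr, ipZl, ipZr) !ip_norm (ipC y x) => h.
rewrite -(ler_pM2l xy0); lra.
Qed.

End InnerProduct.

(** * Operator norm estimates *)

Section OperatorNorm.
Context (R : realType) (X : normedModType R) (T : {linear X -> X})
  (cT : continuous T).

Lemma opnorm_has_ubound :
  has_ubound [set `|T x| | x in [set x : X | `|x| <= 1]].
Proof.
have /linear_boundedP/pinfty_ex_gt0[M M0 TM] :=
  (linear_bounded_continuous T).2 cT.
exists M => _ [x /= x1 <-]; apply: le_trans (TM x) _.
by rewrite -[leRHS]mulr1 ler_wpM2l// ltW.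
Qed.

Lemma opnorm_ge0 : 0 <= opnorm T.
Proof.
apply: (ub_le_sup opnorm_has_ubound); exists 0; first by rewrite /= normr0 ler01.
by rewrite linear0 normr0.
Qed.

Lemma ler_opnorm x : `|T x| <= opnorm T * `|x|.
Proof.
have [->|x0] := eqVneq x 0; first by rewrite linear0 !normr0 mulr0.
have nx : 0 < `|x| by rewrite normr_gt0.
rewrite -ler_pdivrMr//; apply: (ub_le_sup opnorm_has_ubound).
exists (`|x|^-1 *: x) => /=.
  by rewrite normrZ ger0_norm ?invr_ge0// mulVf ?gt_eqF.
by rewrite linearZ/= normrZ ger0_norm ?invr_ge0// mulrC.
Qed.

(** For [l > opnorm T] this bounds the inverse of [T - l]; it serves both the continuity of [vhat]
    and the decay of [gfun]. *)
Lemma opnorm_ler_subr l x : (l - opnorm T) * `|x| <= `|T x - l *: x|.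
Proof.
have := ler_opnorm x.
have := lerB_dist (l *: x) (T x).
rewrite normrZ distrC.
have := ler_wpM2r (normr_ge0 x) (ler_norm l).
lra.
Qed.

Lemma opnorm_coercive (ip : X -> X -> R) l x : is_inner_product ip ->
  (l - opnorm T) * `|x| ^+ 2 <= ip (l *: x - T x) x.
Proof.
move=> ipP; rewrite (ipBl ipP) (ipZl ipP) (ip_norm ipP) mulrBl lerB//.
rewrite (le_trans (ip_le_norm ipP _ _))// expr2 mulrA ler_wpM2r//.
exact: ler_opnorm.
Qed.

End OperatorNorm.

(** * Differentiability from supergradients *)

Lemma near_dist_lt (R : realType) (x e : R) :
  0 < e -> \forall y \near x, `|x - y| < e.
Proof. by move=> e0; apply/nbhs_normP; exists e. Qed.

(* [l] selects supergradients of [f], so each difference quotient of [f] at [r]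
   lies between [l r] and the value of [l] at the other endpoint. *)
Lemma supergradient_is_derive (R : realType) (f l : R -> R) (r : R) :
  {for r, continuous l} ->
  (\forall s \near r, f s - f r <= l r * (s - r) /\
                      f r - f s <= l s * (r - s)) ->
  is_derive r 1 f (l r).
Proof.
move=> cl sg.
have shift : (fun h : R => h *: 1 + r) @ 0^' --> r.
  have: (fun h : R => h *: 1 + r) @ 0 --> 0 *: 1 + r.
    by apply: cvgD; [apply: cvgZr_tmp; exact: cvg_id|exact: cvg_cst].
  rewrite scale0r add0r => c; apply: cvg_trans c.
  by apply: cvg_app; exact: nbhs_dnbhs.
have lim : h^-1 *: (f (h *: 1 + r) - f r) @[h --> 0^'] --> l r.
  apply/cvgrPdist_le => e e0.
  have /cvgrPdist_le/(_ e e0) nl := cvg_comp _ _ shift cl.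
  have ns := shift _ sg.
  near=> h.
  have h0 : h != 0 by near: h; exact: nbhs_dnbhs_neq.
  have lh : `|l r - l (h *: 1 + r)| <= e by near: h.
  have [] : f (h *: 1 + r) - f r <= l r * (h *: 1 + r - r) /\
     f r - f (h *: 1 + r) <= l (h *: 1 + r) * (r - (h *: 1 + r)) by near: h.
  move: lh; set s := h *: 1 + r => lh.
  have -> : s - r = h by rewrite /s addrK -[_ *: _]/(h * 1) mulr1.
  have -> : r - s = - h.
    by rewrite /s opprD addrCA subrr addr0 -[_ *: _]/(h * 1) mulr1.
  rewrite -[_ *: _]/(_ * _); set q := h^-1 * _ => h1 h2.
  have fq : f s - f r = h * q by rewrite /q mulrA divff// mul1r.
  move: lh; rewrite !ler_norml => /andP[e1 e2].
  (* Dividing by [h] gives [l s <= q <= l r] for [h > 0] and the reverse order for [h < 0]. *)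
  case: (ltgtP h 0) h0 => // hs _.
    have : q <= l s by rewrite -(ler_nM2l hs); lra.
    have : l r <= q by rewrite -(ler_nM2l hs); lra.
    by move=> *; apply/andP; split; lra.
  have : l s <= q by rewrite -(ler_pM2l hs); lra.
  have : q <= l r by rewrite -(ler_pM2l hs); lra.
  by move=> *; apply/andP; split; lra.
by split; [apply/cvg_ex; exists (l r)|apply: cvg_lim].
Unshelve. all: by end_near. Qed.

(** * Solutions of the equation and their dependence on [l] *)

Section Resolvent.
Context (R : realType) (X : completeNormedModType R) (ip : X -> X -> R)
  (T : {linear X -> X}) (z : X).
Context (ipP : is_inner_product ip) (z0 : z != 0) (cT : continuous T)
  (symT : symmetric_op ip T).

Local Notation nT := (opnorm T).
Local Notation v := (vhat T z).
Local Notation g := (gfun T z).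
Local Notation I := (Itheta T z).
Local Notation J := (Jfun ip T z).
Local Notation gam := (gamma ip T z).
Local Notation xh := (xhat T z).
Local Notation li := (ginv T z).

Lemma resolvent_solvable l : nT < l -> exists x, T x - l *: x = z.
Proof.
move=> lT; have l0 : 0 < l by exact: le_lt_trans (opnorm_ge0 cT) lT.
(* Fixed points of [f] are the solutions, and [f] contracts with ratio [nT / l < 1]. *)
pose f (x : X) : X := l^-1 *: (T x - z).
have fT : set_fun [set: X] [set: X] f by [].
pose F : {fun [set: X] >-> [set: X]} := HB.pack f (isFun.Build _ _ _ _ f fT).
have li0 : 0 <= l^-1 by rewrite invr_ge0 ltW.
have q0 : 0 <= nT / l by rewrite divr_ge0 ?opnorm_ge0// ltW.
have cF : is_contraction F.
  exists (NngNum q0); split => /=; first by rewrite ltr_pdivrMr// mul1r.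
  move=> [x y] _ /=; rewrite /f -scalerBr opprB addrA subrK -linearB normrZ.
  rewrite (ger0_norm li0) [leRHS]mulrAC mulrC ler_wpM2r//.
  exact: ler_opnorm.
have [|p _ /= pE] := banach_fixed_point cF closedT; first by exists 0.
exists p; rewrite {2}pE /f scalerA divff ?gt_eqF// scale1r opprB addrC.
by rewrite subrK.
Qed.

Lemma vhatP l : nT < l -> T (v l) - l *: v l = z.
Proof.
move=> /resolvent_solvable[x xz].
exact: (@xgetPex _ 0 [set x | T x - l *: x = z]) (ex_intro _ x xz).
Qed.

Lemma vhat_neq0 l : nT < l -> v l != 0.
Proof.
move=> /vhatP vE; apply: contra_neq z0 => v0.
by rewrite -vE v0 linear0 scaler0 subrr.
Qed.

Lemma gfun_gt0 l : nT < l -> 0 < g l.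
Proof. by move=> lT; rewrite /gfun exprn_gt0// normr_gt0 vhat_neq0. Qed.

Lemma ip_sqrB x y : `|x| ^+ 2 = `|x - y| ^+ 2 + 2 * ip y (x - y) + `|y| ^+ 2.
Proof.
by rewrite -!(ip_norm ipP) !(ipBl ipP, ipBr ipP) (ipC ipP y x); ring.
Qed.

(* Since [(m - T) (x - y) = (l - m) y] and [m - T] is positive, [y] makes an
   acute angle with [x - y]. *)
Lemma solution_dist m l x y : nT <= m -> m < l ->
  T x - m *: x = z -> T y - l *: y = z ->
  `|x - y| ^+ 2 <= `|x| ^+ 2 - `|y| ^+ 2.
Proof.
move=> mT ml xz yz.
have E : m *: (x - y) - T (x - y) = (l - m) *: y.
  move: xz => /eqP; rewrite subr_eq => /eqP Tx.
  move: yz => /eqP; rewrite subr_eq => /eqP Ty.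
  rewrite [T (_ - _)]linearB/= Tx Ty.
  by rewrite [z + _]addrC addrKA scalerBr scalerBl opprB addrC addrA subrK.
have := opnorm_coercive cT m (x - y) ipP.
rewrite E (ipZl ipP) => h.
have : 0 <= ip y (x - y).
  rewrite -(pmulr_rge0 _ (_ : 0 < l - m)) ?subr_gt0//.
  by apply: le_trans h; rewrite mulr_ge0 ?sqr_ge0 ?subr_ge0.
by have := ip_sqrB x y; lra.
Qed.

Lemma solution_norm_lt m l x y : nT <= m -> m < l ->
  T x - m *: x = z -> T y - l *: y = z -> `|y| ^+ 2 < `|x| ^+ 2.
Proof.
move=> mT ml xz yz; have D := solution_dist mT ml xz yz.
rewrite -subr_gt0; apply: lt_le_trans D.
(* A common solution for [m] and [l] would satisfy [(l - m) x = 0], so [x = 0] and hence [z = 0]. *)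
rewrite exprn_gt0// normr_gt0 subr_eq0; apply: contra_neq z0 => xy.
move: yz; rewrite -xy -xz => /addrI/oppr_inj/eqP.
rewrite eq_sym -subr_eq0 -scalerBl scaler_eq0 subr_eq0 lt_eqF//= => /eqP ->.
by rewrite linear0 scaler0 subr0.
Qed.

Lemma gfun_decreasing l1 l2 : nT < l1 -> l1 < l2 -> g l2 < g l1.
Proof.
move=> l1T l12; apply: (solution_norm_lt (ltW l1T) l12); apply: vhatP => //.
exact: lt_trans l12.
Qed.

(** As a function of the value of [g], the solution is thus Hölder of exponent 1/2, which makes
    [xhat] continuous. *)
Lemma vhat_dist m l : nT < m -> nT < l -> `|v m - v l| ^+ 2 <= `|g m - g l|.
Proof.
wlog : m l / m <= l => [W|].
  by case: (leP m l) => h mT lT; [exact: W|rewrite distrC [leRHS]distrC W// ltW].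
rewrite le_eqVlt => /orP[/eqP->|ml] mT lT.
  by rewrite !subrr !normr0 expr0n.
apply: le_trans (ler_norm _).
exact: solution_dist (ltW mT) ml (vhatP mT) (vhatP lT).
Qed.

(** Subtracting the two equations gives [(T - l) (v m - v l) = (m - l) v m], and [T - l] is bounded
    below. *)
Lemma vhat_lipschitz m l : nT < m -> nT < l ->
  (l - nT) * `|v m - v l| <= `|l - m| * `|v m|.
Proof.
move=> mT lT; have := opnorm_ler_subr cT l (v m - v l).
congr (_ <= _); rewrite -normrZ -[LHS]normrN opprB; congr `|_|.
have /eqP := vhatP mT; rewrite subr_eq => /eqP Tm.
have /eqP := vhatP lT; rewrite subr_eq => /eqP Tl.
rewrite [T (_ - _)]linearB/= Tm Tl [z + m *: _]addrC addrKA.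
by rewrite scalerBr scalerBl opprB addrA subrK.
Qed.

Lemma vhat_continuous l : nT < l -> {for l, continuous v}.
Proof.
move=> lT; apply/(@cvgrPdist_le _ _ _ (nbhs l)) => e e0.
(* Within half the gap, [m - nT] stays above [(l - nT) / 2], so the Lipschitz bound is uniform in
   [m]. *)
have d0 : 0 < (l - nT) / 2 by rewrite divr_gt0// subr_gt0.
pose K := `|v l| + 1.
have K0 : 0 < K by rewrite ltr_wpDl.
have e'0 : 0 < e * ((l - nT) / 2) / K by rewrite divr_gt0// mulr_gt0.
near=> m.
have m1 : `|l - m| < (l - nT) / 2.
  by near: m; exact: near_dist_lt.
have m2 : `|l - m| < e * ((l - nT) / 2) / K.
  by near: m; exact: near_dist_lt.
have mT : (l - nT) / 2 < m - nT by move: m1; rewrite ltr_norml => /andP[]; lra.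
have mT' : nT < m by rewrite -subr_gt0; exact: lt_trans mT.
have L := vhat_lipschitz lT mT'.
rewrite -(ler_pM2l d0).
apply: (@le_trans _ _ (`|m - l| * `|v l|)).
  by apply: le_trans L; rewrite ler_wpM2r// ltW.
apply: (@le_trans _ _ (`|l - m| * K)).
  by rewrite distrC ler_wpM2l// lerDl.
by rewrite -ler_pdivlMr// (mulrC _ e) ltW.
Unshelve. all: by end_near. Qed.

Lemma gfun_continuous l : nT < l -> {for l, continuous g}.
Proof.
move=> /vhat_continuous c; rewrite /gfun.
by apply: cvgM; exact: cvg_norm.
Qed.

(** * The range of [g] *)

Lemma gfun_small r : 0 < r -> exists2 l, nT < l & g l < r.
Proof.
(* With this [d >= 1], [d^2 r >= d r = r + |z|^2 > |z|^2], whereas [d^2 g (nT + d) <= |z|^2]. *)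
move=> r0; pose d := 1 + `|z| ^+ 2 / r.
have d1 : 1 <= d by rewrite lerDl divr_ge0 ?sqr_ge0// ltW.
have d0 : 0 < d by exact: lt_le_trans d1.
have lT : nT < nT + d by rewrite ltrDl.
exists (nT + d) => //.
have := opnorm_ler_subr cT (nT + d) (v (nT + d)); rewrite vhatP//.
rewrite addrAC subrr add0r => h.
have {h}: (d * `|v (nT + d)|) ^+ 2 <= `|z| ^+ 2.
  by rewrite ler_sqr ?nnegrE ?mulr_ge0// ltW.
rewrite exprMn => h.
rewrite /gfun -(ltr_pM2l (exprn_gt0 2 d0)); apply: le_lt_trans h _.
apply: (@lt_le_trans _ _ (d * r)).
  by rewrite mulrDl mul1r divfK ?gt_eqF// ltrDr.
by rewrite ler_pM2r// expr2 ler_peMl// ltW.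
Qed.

(* If [g] is bounded then [v] is Cauchy as [l] decreases to [nT], by
   [solution_dist]; the limit solves the equation at [nT]. *)
Lemma Vset_of_gfun_bounded r : (forall l, nT < l -> g l <= r) ->
  exists2 x, Vset T z x & `|x| ^+ 2 <= r.
Proof.
move=> gr.
pose G := [set g l | l in [set l | nT < l]].
have hG : has_sup G.
  split; first by exists (g (nT + 1)), (nT + 1) => //=; rewrite ltrDl.
  by exists r => _ [l /= lT <-]; exact: gr.
have cv : cvg (v @ nT^'+).
  apply/cauchy_cvgP/cauchy_exP => e e0.
  (* Once [g l] is within [e^2] of the supremum, [solution_dist] puts every [v m] with [nT < m < l]
     within [e] of [v l]. *)
  have [_ [l /= lT <-] gl] := sup_adherent (exprn_gt0 2 e0) hG.
  exists (v l).
  near=> m; rewrite -ball_normE /=.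
  have mT : nT < m by near: m; exact: nbhs_right_gt.
  have ml : m < l by near: m; exact: nbhs_right_lt.
  have D := solution_dist (ltW mT) ml (vhatP mT) (vhatP lT).
  rewrite distrC -ltr_sqr ?nnegrE ?(ltW e0)//.
  have : g m <= sup G by apply: sup_upper_bound => //; exists m.
  by move: D gl; rewrite -/(gfun T z m) -/(gfun T z l); lra.
pose x := lim (v @ nT^'+); have vx : v @ nT^'+ --> x by [].
exists x.
- have lid : (fun l : R => l) @ nT^'+ --> nT.
    by apply: cvg_at_right_filter; exact: cvg_id.
  have c1 : T (v l) - l *: v l @[l --> nT^'+] --> T x - nT *: x.
    by apply: cvgB; [apply: cvg_comp vx _; exact: cT|apply: cvgZ].
  have c2 : T (v l) - l *: v l @[l --> nT^'+] --> z.
    apply: cvg_near_cst; near=> l; apply: vhatP.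
    by near: l; exact: nbhs_right_gt.
  exact: cvg_unique c1 c2.
- have c : `|v l| ^+ 2 @[l --> nT^'+] --> `|x| ^+ 2.
    by rewrite expr2; apply: cvgM; exact: cvg_norm.
  rewrite -(cvg_lim _ c)//; apply: limr_le.
    by apply/cvg_ex; eexists; exact: c.
  near=> l; apply: gr; near: l; exact: nbhs_right_gt.
Unshelve. all: by end_near. Qed.

Lemma gfun_lt_theta l : nT < l -> ((g l)%:E < theta T z)%E.
Proof.
(* Passing to the infimum leaves only a weak inequality; the intermediate [m] restores
   strictness. *)
move=> lT; pose m := (nT + l) / 2.
have mT : nT < m by rewrite /m ltr_pdivlMr//; lra.
have ml : m < l by rewrite /m ltr_pdivrMr//; lra.
apply: (@lt_le_trans _ _ (g m)%:E); first by rewrite lte_fin gfun_decreasing.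
apply: le_ereal_inf_tmp => _ [x /= xV <-]; rewrite lee_fin ltW//.
exact: solution_norm_lt (lexx _) mT xV (vhatP mT).
Qed.

Lemma gfun_image : [set g l | l in [set l | nT < l]] = I.
Proof.
apply/seteqP; split => [_ [l /= lT <-]|r [r0 rth]].
  by split; [exact: gfun_gt0|exact: gfun_lt_theta].
have [b bT gb] := gfun_small r0.
have [a aT ga] : exists2 a, nT < a & r < g a.
  apply: contrapT => h.
  have [l lT|x xV xr] := @Vset_of_gfun_bounded r.
    by rewrite leNgt; apply/negP => lr; apply: h; exists l.
  move: rth; rewrite ltNge => /negP; apply.
  apply: (@le_trans _ _ (`|x| ^+ 2)%:E); last by rewrite lee_fin.
  by apply: ereal_inf_lbound; exists x.
have ab : a <= b.
  by rewrite leNgt; apply/negP => /(gfun_decreasing bT); lra.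
have [||c] := @IVT R g a b r ab.
- apply: continuous_in_subspaceT => c; rewrite inE/= in_itv/= => /andP[ac _].
  by apply: gfun_continuous; exact: lt_le_trans ac.
- by rewrite ge_min le_max (ltW gb) (ltW ga) orbT.
- rewrite in_itv/= => /andP[ac _] <-; exists c => //=; exact: lt_le_trans ac.
Qed.

(** * The inverse of [g] and continuity of [xhat] *)

Lemma ginvP r : I r -> nT < li r /\ g (li r) = r.
Proof.
rewrite -gfun_image => -[l /= lT gl].
exact: (@xgetPex _ 0 [set l | nT < l /\ g l = r]) (ex_intro _ l (conj lT gl)).
Qed.

(** Openness of [I] and continuity of [ginv] together: [s] is trapped between [g (l + d)] and
    [g (l - d)], with [d] small enough that [l - d > nT]. *)
Lemma ginv_near r e : I r -> 0 < e ->
  \forall s \near r, I s /\ `|li r - li s| < e.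
Proof.
move=> Ir e0; have [lT gl] := ginvP Ir; set l := li r in lT gl *.
pose d := Num.min e ((l - nT) / 2).
have d0 : 0 < d by rewrite lt_min e0 divr_gt0// subr_gt0.
have de : d <= e by rewrite ge_min lexx.
have dT : d < l - nT.
  by rewrite gt_min; apply/orP; right; lra.
have h1 : nT < l - d by lra.
have h2 : l - d < l by lra.
have h3 : l < l + d by lra.
have g1 := gfun_decreasing h1 h2; have g2 := gfun_decreasing lT h3.
rewrite gl in g1 g2.
near=> s.
have s1 : s < g (l - d) by near: s; exact: lt_nbhsl.
have s2 : g (l + d) < s by near: s; exact: lt_nbhsr.
have Is : I s.
  split; first by apply: lt_trans s2; apply: gfun_gt0; lra.
  by apply: lt_trans (gfun_lt_theta h1); rewrite lte_fin.
split => //; have [mT gm] := ginvP Is; set m := li s in mT gm *.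
have m1 : l - d < m.
  rewrite ltNge le_eqVlt; apply/negP => /orP[/eqP E|/(gfun_decreasing mT)].
    by move: s1; rewrite -E gm ltxx.
  by lra.
have m2 : m < l + d.
  have h4 : nT < l + d by lra.
  rewrite ltNge le_eqVlt; apply/negP => /orP[/eqP E|/(gfun_decreasing h4)].
    by move: s2; rewrite E gm ltxx.
  by lra.
by rewrite ltr_norml; apply/andP; split; lra.
Unshelve. all: by end_near. Qed.

Lemma ginv_continuous r : I r -> {for r, continuous li}.
Proof.
move=> Ir; apply/(@cvgrPdist_lt _ _ _ (nbhs r)) => e e0.
by apply: filterS (ginv_near Ir e0) => s [].
Qed.

Lemma xhat_norm r : I r -> `|xh r| ^+ 2 = r.
Proof. by move=> /ginvP[]. Qed.

Lemma xhat_eq r : I r -> T (xh r) - li r *: xh r = z.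
Proof. by move=> /ginvP[? _]; exact: vhatP. Qed.

Lemma xhat_continuous r : I r -> {for r, continuous xh}.
Proof.
move=> Ir; apply/(@cvgrPdist_lt _ _ _ (nbhs r)) => e e0.
have e20 : 0 < e ^+ 2 by rewrite exprn_gt0.
near=> s.
have Is : I s by near: s; apply: filterS (ginv_near Ir ltr01) => ? [].
have rs : `|r - s| < e ^+ 2.
  by near: s; exact: near_dist_lt.
have [lT gl] := ginvP Ir; have [mT gm] := ginvP Is.
rewrite -ltr_sqr ?nnegrE ?(ltW e0)//; apply: le_lt_trans rs.
by have := vhat_dist lT mT; rewrite gl gm.
Unshelve. all: by end_near. Qed.

(* Completing the square: [J y - l |y|^2] is a concave quadratic in [y], whose
   maximum is attained at the solution [x] of [T x - l x = z]. *)
Lemma Jfun_le l x y : T x - l *: x = z ->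
  J y + (l - nT) * `|y - x| ^+ 2 <= J x + l * (`|y| ^+ 2 - `|x| ^+ 2).
Proof.
move=> xz; have := opnorm_coercive cT l (y - x) ipP.
have -> : ip (l *: (y - x) - T (y - x)) (y - x) =
    J x - J y + l * (`|y| ^+ 2 - `|x| ^+ 2); last by lra.
rewrite /Jfun -xz [T (_ - _)]linearB/= -!(ip_norm ipP).
rewrite !(ipBl ipP, ipBr ipP, ipZl ipP) (ipC ipP y x) (symT y x); ring.
Qed.

(** * Maximization of [J] on spheres *)

(** The quadratic gap yields both uniqueness of the maximum and convergence of maximizing
    sequences. *)
Lemma Jfun_xhat_le r x : I r -> Sr r x ->
  J x + (li r - nT) * `|x - xh r| ^+ 2 <= J (xh r).
Proof.
move=> Ir xr; have := Jfun_le x (xhat_eq Ir).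
by rewrite (xhat_norm Ir) xr subrr mulr0 addr0.
Qed.

Lemma gamma_xhat r : I r -> gam r = J (xh r).
Proof.
move=> Ir; have [lT _] := ginvP Ir.
have ub : ubound [set J x | x in Sr r] (J (xh r)).
  move=> _ [x xr <-]; apply: le_trans (Jfun_xhat_le Ir xr).
  by rewrite lerDl mulr_ge0 ?sqr_ge0// subr_ge0 ltW.
have m : [set J x | x in Sr r] (J (xh r)).
  by exists (xh r) => //; exact: xhat_norm.
apply/eqP; rewrite eq_le; apply/andP; split.
  by apply: ge_sup => //; exists (J (xh r)).
by apply: ub_le_sup => //; exists (J (xh r)).
Qed.

Lemma Jfun_lt_xhat r x : I r -> Sr r x -> x != xh r -> J x < J (xh r).
Proof.
move=> Ir xr xx; have [lT _] := ginvP Ir.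
apply: lt_le_trans (Jfun_xhat_le Ir xr).
by rewrite ltrDl mulr_gt0 ?subr_gt0// exprn_gt0// normr_gt0 subr_eq0.
Qed.

Lemma maximizing_cvg r (u : nat -> X) : I r -> (forall n, Sr r (u n)) ->
  (J \o u) @ \oo --> gam r -> u @ \oo --> xh r.
Proof.
move=> Ir ur; rewrite (gamma_xhat Ir) => Ju; have [lT _] := ginvP Ir.
have d0 : 0 < li r - nT by rewrite subr_gt0.
apply/cvgrPdist_lt => e e0.
have ee : 0 < (li r - nT) * e ^+ 2 by rewrite mulr_gt0// exprn_gt0.
move/cvgrPdist_lt: Ju => /(_ _ ee) Ju.
near=> n.
have : `|J (xh r) - (J \o u) n| < (li r - nT) * e ^+ 2 by near: n.
move=> /(le_lt_trans (ler_norm _)) /= h.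
rewrite distrC -ltr_sqr ?nnegrE ?(ltW e0)// -(ltr_pM2l d0).
by have := Jfun_xhat_le Ir (ur n); lra.
Unshelve. all: by end_near. Qed.

(** * Derivative, monotonicity and concavity of [gamma] *)

(** [Jfun_le] compares the maximizers at [s] and [r]; it is strict because their norms differ. *)
Lemma gamma_supergradient r s : I r -> I s -> s != r ->
  gam s - gam r < li r * (s - r).
Proof.
move=> Ir Is sr; have [lT _] := ginvP Ir; rewrite !gamma_xhat//.
have := Jfun_le (xh s) (xhat_eq Ir).
rewrite !xhat_norm//.
suff : 0 < (li r - nT) * `|xh s - xh r| ^+ 2 by lra.
rewrite mulr_gt0 ?subr_gt0// exprn_gt0// normr_gt0 subr_eq0.
by apply: contra_neq sr => E; rewrite -(xhat_norm Is) -(xhat_norm Ir) E.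
Qed.

Lemma gamma_is_derive r : I r -> is_derive r 1 gam (li r).
Proof.
move=> Ir; apply: supergradient_is_derive; first exact: ginv_continuous.
near=> s.
have Is : I s by near: s; apply: filterS (ginv_near Ir ltr01) => ? [].
have [->|sr] := eqVneq s r; first by rewrite !subrr !mulr0.
by split; apply: ltW; apply: gamma_supergradient => //; rewrite eq_sym.
Unshelve. all: by end_near. Qed.

Lemma gamma_derive1 r : I r -> derive1 gam r = li r.
Proof. by move=> /gamma_is_derive h; rewrite derive1E; exact: derive_val. Qed.

Lemma gamma_derive1_continuous r : I r -> {for r, continuous (derive1 gam)}.
Proof.
move=> Ir; rewrite /prop_for /continuous_at gamma_derive1//.
apply: cvg_trans (ginv_continuous Ir); apply: near_eq_cvg.
near=> s; rewrite gamma_derive1//.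
by near: s; apply: filterS (ginv_near Ir ltr01) => ? [].
Unshelve. all: by end_near. Qed.

Lemma gamma_increasing r1 r2 : I r1 -> I r2 -> r1 < r2 -> gam r1 < gam r2.
Proof.
move=> I1 I2 r12; have [lT _] := ginvP I2.
(* At the larger point the supergradient [li r2] exceeds [nT >= 0]. *)
have := gamma_supergradient I2 I1 (negbT (lt_eqF r12)).
suff : 0 < li r2 * (r2 - r1) by lra.
by rewrite mulr_gt0 ?subr_gt0//; exact: le_lt_trans (opnorm_ge0 cT) lT.
Qed.

Lemma Itheta_convex r1 r2 t : I r1 -> I r2 -> 0 < t -> t < 1 ->
  I ((1 - t) * r1 + t * r2).
Proof.
move=> [r10 r1t] [r20 r2t] t0 t1.
have t1' : 0 < 1 - t by rewrite subr_gt0.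
split; first by rewrite addr_gt0// mulr_gt0.
(* Since [theta] may be [+oo], the comparison goes through the real number [max r1 r2]. *)
apply: (@le_lt_trans _ _ (Num.max r1 r2)%:E).
  have m1 : r1 <= Num.max r1 r2 by rewrite le_max lexx.
  have m2 : r2 <= Num.max r1 r2 by rewrite le_max lexx orbT.
  have := ler_wpM2l (ltW t1') m1; have := ler_wpM2l (ltW t0) m2.
  by rewrite lee_fin; lra.
by case: (leP r1 r2).
Qed.

Lemma gamma_strictly_concave r1 r2 t : I r1 -> I r2 -> r1 != r2 ->
  0 < t -> t < 1 ->
  (1 - t) * gam r1 + t * gam r2 < gam ((1 - t) * r1 + t * r2).
Proof.
move=> I1 I2 r12 t0 t1; have Ir := Itheta_convex I1 I2 t0 t1.
have t1' : 0 < 1 - t by rewrite subr_gt0.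
set r := _ + _ in Ir *.
have n1 : r1 != r.
  have : t * (r2 - r1) != 0 by rewrite mulf_neq0 ?(gt_eqF t0)// subr_eq0 eq_sym.
  by apply: contra_neq; rewrite /r; lra.
have n2 : r2 != r.
  have : (1 - t) * (r1 - r2) != 0 by rewrite mulf_neq0 ?(gt_eqF t1')// subr_eq0.
  by apply: contra_neq; rewrite /r; lra.
(* The supergradient inequalities at [r] are averaged with weights [1 - t] and [t]; their linear
   terms cancel. *)
have := gamma_supergradient Ir I1 n1; rewrite -(ltr_pM2l t1') => h1.
have := gamma_supergradient Ir I2 n2; rewrite -(ltr_pM2l t0) => h2.
have E : (1 - t) * (li r * (r1 - r)) + t * (li r * (r2 - r)) = 0.
  by rewrite /r; ring.
lra.
Qed.

End Resolvent.

Theorem theorem1 (R : realType) (X : completeNormedModType R)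
  (ip : X -> X -> R) (T : {linear X -> X}) (z : X) :
  is_inner_product ip ->
  z != 0 ->
  continuous T ->
  compact_op T ->
  symmetric_op ip T ->
  let nT := opnorm T in
  let g := gfun T z in
  let I := Itheta T z in
  let J := Jfun ip T z in
  let gam := gamma ip T z in
  let xh := xhat T z in
  (* (b1) *)
  ((forall l1 l2, nT < l1 -> l1 < l2 -> g l2 < g l1) /\
   [set g l | l in [set l | nT < l]] = I) /\
  (* (b2) *)
  (forall r, I r ->
     (Sr r (xh r) /\ (forall x, Sr r x -> x != xh r -> J x < J (xh r))) /\
     (forall u : nat -> X, (forall n, Sr r (u n)) ->
        (J \o u) @ \oo --> gam r -> u @ \oo --> xh r)) /\
  (* (b3) *)
  (forall r, I r -> {for r, continuous xh}) /\
  (* (b4) *)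
  ((forall r, I r -> derivable gam r 1 /\ {for r, continuous ((derive1 gam))}) /\
   (forall r1 r2, I r1 -> I r2 -> r1 < r2 -> gam r1 < gam r2) /\
   (forall r1 r2 t, I r1 -> I r2 -> r1 != r2 -> 0 < t -> t < 1 ->
      (1 - t) * gam r1 + t * gam r2 < gam ((1 - t) * r1 + t * r2))) /\
  (* (b5) *)
  (forall r, I r -> T (xh r) - (derive1 gam) r *: xh r = z) /\
  (* (b6) *)
  (forall r, I r -> (derive1 gam) r = ginv T z r).
Proof.
move=> ipP z0 cT _ symT nT g I J gam xh.
split; [|split; [|split; [|split; [|split]]]].
- by split; [exact: gfun_decreasing ipP z0 cT|exact: gfun_image ipP z0 cT].
- move=> r Ir; split.
    by split; [exact: xhat_norm ipP z0 cT _ Ir|move=> x; exact: Jfun_lt_xhat].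
  by move=> u; exact: maximizing_cvg ipP z0 cT symT _ u Ir.
- by move=> r; exact: xhat_continuous ipP z0 cT r.
- split; [|split].
  + move=> r Ir; split; last exact: gamma_derive1_continuous.
    by have [] := gamma_is_derive ipP z0 cT symT Ir.
  + exact: gamma_increasing.
  + exact: gamma_strictly_concave.
- by move=> r Ir; rewrite gamma_derive1//; exact: xhat_eq ipP z0 cT r Ir.
- exact: gamma_derive1.
Qed.
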